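(* Let $X$, $A$, the tessellation $\{Y_k\}_{k=0}^m$, the data $\{(x_i,f_i)\}_{i=1}^n$, $M>0$ and $\varepsilon>0$ be given. For any vector field $f$ satisfying the standing assumptions 1, 2, 3 and 5 of the context, and for any optimal solution $\big(\{b_k\}_{k=0}^m,\{\gamma_{i,k}\},g_0,\{s_{k,l}\}\big)$ of the learning problem (P) whose optimal value satisfies $$s_\varepsilon^\star=-\varepsilon\sum_{k=1}^m\nu_k ,$$ the function $V$ defined by $$V(x)=\sum_{i=1}^n\gamma_{i,k}^\top x+b_k\quad (x\in Y_k,\ k\in\{1,\dots,m\}),\qquad V(x)=g_0^\top x+b_0\quad(x\in Y_0=A),$$ is a generalized Lyapunov function in the sense that for all $a\in\mathbb{R}$ satisfying $L_a^V\subset X$, it holds that $L_a^V\subset R$, i.e. $$\forall\, x_0\in L_a^V,\qquad \lim_{t\to\infty}\|x(t|x_0)\|=0 .$$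
   Context: Setting. $X\subset\mathbb{R}^d$ is a bounded open set and $f:X\to\mathbb{R}^d$ is a vector field. The system is $\dot x=f(x)$ with the constraint $x(t)\in X$ for all $t\ge 0$. $\|\cdot\|$ is the $q$-norm on $\mathbb{R}^d$ for a fixed $q\in[1,\infty]$ and $\|\cdot\|^*$ is its dual norm. Standing assumptions: 1. $f$ is Lipschitz continuous on $X$, and $x(t|x_0)$ denotes the solution at time $t$ with $x(0)=x_0$. $f$ has a single equilibrium point in $X$, which is the origin $0$, and it is locally asymptotically stable. 2. The finite dataset $D=\{(x_i,f_i)\}_{i=1}^n\subset X\times\mathbb{R}^d$ satisfies $f_i=f(x_i)$. 3. $A$ is a compact set with $A\subset\mathrm{int}(R)$ and $0\in\mathrm{int}(A)$, where $R=\{x_0\in X:\lim_{t\to\infty}\|x(t|x_0)\|=0\}$ is the region of attraction (trajectories being solutions of the constrained system, i.e. defined and staying in $X$ for all $t\ge0$). 4. $\overline X$ and $A$ are polytopes, a polytope being a bounded finite union of polyhedra (finite intersections of half-spaces), not necessarily convex. 5. $\|f(x)-f(y)\|\le M\|x-y\|$ for all $x,y\in X$. Tessellation. $Y_1,\dots,Y_m$ are convex polytopes with $\overline{X\setminus A}=\bigcup_{k=1}^m Y_k$ and $\mathrm{int}(Y_k)\cap\mathrm{int}(Y_{k'})=\varnothing$ for $k\ne k'$; $Y_0=A$; $\{y_{k,l}\}_{l=1}^{\nu_k}$ is the set of vertices of $Y_k$ for $1\le k\le m$. Learning problem (P). Over variables $b_k\in\mathbb{R}$ ($0\le k\le m$),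 $\gamma_{i,k}\in\mathbb{R}^d$ ($1\le i\le n$, $1\le k\le m$), $g_0\in\mathbb{R}^d$, $s_{k,l}\in\mathbb{R}$ ($1\le k\le m$, $1\le l\le\nu_k$), minimize $\sum_{k=1}^m\sum_{l=1}^{\nu_k}s_{k,l}$ (optimal value denoted $s_\varepsilon^\star$) subject to, for all $k\in\{1,\dots,m\}$ and $l\in\{1,\dots,\nu_k\}$: - if $y_{k,l}\in Y_0$: $\ \sum_{i=1}^n\gamma_{i,k}^\top y_{k,l}=g_0^\top y_{k,l}+b_0-b_k$; - for every $k'\in\{1,\dots,m\}$ with $y_{k,l}\in Y_{k'}$: $\ \sum_{i=1}^n(\gamma_{i,k}-\gamma_{i,k'})^\top y_{k,l}=b_{k'}-b_k$; - $s_{k,l}\ge-\varepsilon$; - $\sum_{i=1}^n\big(f_i^\top\gamma_{i,k}+M\|\gamma_{i,k}\|^*\|x_i-y_{k,l}\|\big)\le s_{k,l}$. Standing requirement on Lyapunov candidates: the piecewise affine function $V$ is well defined and continuous across cells (the equality constraints in (P) are meant to encode this). $V$ is then Lipschitz, and it is extended to a Lipschitz continuous function on $\mathbb{R}^d$ with the same Lipschitz constant, still denoted $V$. $L_a^V=\{x\in\mathbb{R}^d:V(x)<a\}$. *)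

(* Defs.v *)
From HB Require Import structures.
From mathcomp Require Import all_boot all_order all_algebra.
From mathcomp Require Import all_classical all_reals all_analysis.

Set Implicit Arguments.
Unset Strict Implicit.
Unset Printing Implicit Defensive.

Import Order.TTheory GRing.Theory Num.Theory.
Import numFieldNormedType.Exports.

Local Open Scope classical_set_scope.
Local Open Scope ring_scope.

(* R^d is 'rV[R]_d; open, closed, bounded and compact sets are those of its
   canonical (sup-norm) structure, all norms on R^d being equivalent. *)
Section norms.
Context {R : realType} {d : nat}.
Implicit Types (u v x : 'rV[R]_d) (q : \bar R).

Definition dot u v : R := \sum_(j < d) u 0 j * v 0 j.

(* Only meant for 1 <= q; the value at -oo is junk. *)
Definition qnorm q x : R :=
  match q with
  | p%:E => (\sum_(j < d) `|x 0 j| `^ p) `^ p^-1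
  | +oo%E => \big[Num.max/0]_(j < d) `|x 0 j|
  | -oo%E => 0
  end.

Definition dual_qnorm q u : R := sup [set dot u x | x in [set x | qnorm q x <= 1]].

Definition qlipschitz_field q (L : R) (D : set 'rV[R]_d)
    (f : 'rV[R]_d -> 'rV[R]_d) :=
  forall x y, D x -> D y -> qnorm q (f x - f y) <= L * qnorm q (x - y).

Definition qlipschitz q (L : R) (D : set 'rV[R]_d) (V : 'rV[R]_d -> R) :=
  forall x y, D x -> D y -> `|V x - V y| <= L * qnorm q (x - y).

End norms.

Section polytopes.
Context {R : realType} {d : nat}.
Implicit Types (P Y : set 'rV[R]_d).

Definition polyhedron P := exists (N : nat) (c : 'I_N -> 'rV[R]_d) (h : 'I_N -> R),
  (forall j, c j != 0) /\ P = [set x | forall j, dot (c j) x <= h j].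

Definition polytope P := bounded_set P /\
  exists (N : nat) (Q : 'I_N -> set 'rV[R]_d),
    (forall j, polyhedron (Q j)) /\ P = \bigcup_j Q j.

Definition convex_polytope Y := polytope Y /\ convex_set Y.

Definition vertices Y : set 'rV[R]_d :=
  [set y | Y y /\ forall u v (t : R), Y u -> Y v -> 0 < t < 1 ->
                   y = t *: u + (1 - t) *: v -> u = y /\ v = y].

End polytopes.

Section dynamics.
Context {R : realType} {d : nat}.
Implicit Types (X : set 'rV[R]_d) (f : 'rV[R]_d -> 'rV[R]_d).

(* A vector field on X is a total function whose values outside X are never
   constrained nor used.  Only the values x t with t >= 0 matter.  The one-sided
   derivative at t = 0 is f (x 0) automatically, by continuity of x and of f on
   X. *)
Definition trajectory X f (x0 : 'rV[R]_d) (x : R -> 'rV[R]_d) :=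
  [/\ x 0 = x0,
      forall t, 0 <= t -> X (x t),
      {within [set t : R | 0 <= t], continuous x}
    & forall t : R, 0 < t -> is_derive t 1 x (f (x t))].

Definition tends_to_origin (q : \bar R) (x : R -> 'rV[R]_d) :=
  qnorm q (x t) @[t --> +oo] --> (0 : R).

(* f being Lipschitz on X, the trajectory issued from x0 is unique on [0, +oo[
   when it exists. *)
Definition region_of_attraction (q : \bar R) X f : set 'rV[R]_d :=
  [set x0 | X x0 /\ exists x, trajectory X f x0 x /\ tends_to_origin q x].

Definition unique_equilibrium_at_origin X f :=
  [/\ X 0, f 0 = 0 & forall p, X p -> f p = 0 -> p = 0].

Definition locally_asymptotically_stable (q : \bar R) X f :=
  (forall e : R, 0 < e -> exists2 r : R, 0 < r &
     forall x0, X x0 -> qnorm q x0 < r ->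
       exists x, trajectory X f x0 x /\ forall t, 0 <= t -> qnorm q (x t) < e) /\
  (exists2 r : R, 0 < r &
     forall x0, X x0 -> qnorm q x0 < r -> region_of_attraction q X f x0).

End dynamics.

Section tessellations.
Context {R : realType} {d m : nat}.
Implicit Types (X A : set 'rV[R]_d) (Y : 'I_m -> set 'rV[R]_d).

(* The cells Y_1, ..., Y_m are indexed from 0 here; Y_0 = A is kept apart. *)
Definition tessellation X A Y :=
  [/\ forall k, convex_polytope (Y k),
      closure (X `\` A) = \bigcup_k Y k
    & forall k k', k != k' -> (Y k)° `&` (Y k')° = set0].

Definition vertex_enumeration Y (nu : 'I_m -> nat)
    (y : forall k, 'I_(nu k) -> 'rV[R]_d) :=
  forall k, injective (y k) /\ range (y k) = vertices (Y k).

End tessellations.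

Section learning_problem.
Context {R : realType} {d m n : nat} {nu : 'I_m -> nat}.

Record variables := Variables {
  b0 : R;
  g0 : 'rV[R]_d;
  b : 'I_m -> R;
  gamma : 'I_n -> 'I_m -> 'rV[R]_d;
  s : forall k : 'I_m, 'I_(nu k) -> R }.

Definition objective (z : variables) : R := \sum_(k < m) \sum_(l < nu k) s z l.

Definition feasible (q : \bar R) (A : set 'rV[R]_d) (Y : 'I_m -> set 'rV[R]_d)
    (y : forall k, 'I_(nu k) -> 'rV[R]_d) (xd fd : 'I_n -> 'rV[R]_d)
    (M eps : R) : set variables :=
  [set z | forall (k : 'I_m) (l : 'I_(nu k)),
    [/\ A (y k l) ->
          \sum_(i < n) dot (gamma z i k) (y k l) = dot (g0 z) (y k l) + b0 z - b z k,
        forall k', Y k' (y k l) ->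
          \sum_(i < n) dot (gamma z i k - gamma z i k') (y k l) = b z k' - b z k,
        s z l >= - eps
      & \sum_(i < n) (dot (fd i) (gamma z i k)
          + M * dual_qnorm q (gamma z i k) * qnorm q (xd i - y k l)) <= s z l]].

Definition optimal (F : set variables) (z : variables) :=
  F z /\ forall z', F z' -> objective z <= objective z'.

Definition optimal_value (F : set variables) : R := inf [set objective z | z in F].

(* The function V is the already extended one: it is affine as prescribed on
   each cell (so the pieces agree wherever cells meet), and it extends its
   restriction to the union of the cells to R^d without increasing the Lipschitz
   constant. *)
Definition lyapunov_candidate (q : \bar R) (A : set 'rV[R]_d)
    (Y : 'I_m -> set 'rV[R]_d) (z : variables) (V : 'rV[R]_d -> R) :=
  [/\ forall k x, Y k x -> V x = \sum_(i < n) dot (gamma z i k) x + b z k,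
      forall x, A x -> V x = dot (g0 z) x + b0 z,
      exists L, qlipschitz q L setT V
    & forall L, qlipschitz q L (A `|` \bigcup_k Y k) V -> qlipschitz q L setT V].

End learning_problem.

Definition sublevel {R : realType} {d : nat} (V : 'rV[R]_d -> R) (a : R) :
  set 'rV[R]_d := [set x | V x < a].

(* Main.v *)
Require Import Defs.
From HB Require Import structures.
From mathcomp Require Import all_boot all_order all_algebra.
From mathcomp Require Import all_classical all_reals all_analysis.
From mathcomp Require Import ring lra.

Import Order.TTheory GRing.Theory Num.Theory.
Import numFieldNormedType.Exports.

Local Open Scope classical_set_scope.
Local Open Scope ring_scope.

(* The constraint imposed at the vertices of a cell is convex in the vertex, so
   it holds on the whole cell; together with the Lipschitz bound on f it gives
   grad V . f <= - eps on each cell.  Extend f to a globally Lipschitz field F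
   and follow the global solution x of x' = F(x) from x0.  As long as x has not
   met A, V decreases along x at rate at least eps / 2, so x stays in a sublevel
   set contained in X, where F = f.  Since V is bounded below on X, x meets A in
   finite time, and from then on it coincides, by uniqueness, with a trajectory
   that converges to the origin. *)

(** * The q-norm and its dual *)

Section qnorm_theory.
Context {R : realType} {d : nat}.
Implicit Types (x y u v : 'rV[R]_d).

(** The obstacle is that V has no gradient on the common faces of the cells, along which a
    trajectory may travel. Hence only one-sided increments are used: V drops at rate eps on short
    segments in the direction f(x), and Lipschitz continuity of V carries this to the curve up to an
    o(h), which the passage from eps to eps / 2 absorbs. The extension F provides a solution before
    it is known to stay in X; the decrease of V and confinement to X are then obtained together by a
    continuous induction. The dynamics are estimated in the sup norm; the q-norm governs the duality
    bound on each cell and is otherwise compared with the sup norm. *)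

Lemma coord_le_norm x j : `|x 0 j| <= `|x|.
Proof.
rewrite [leRHS]/Num.Def.normr/= mx_normrE.
exact: (le_bigmax _ (fun i : 'I_1 * 'I_d => `|x i.1 i.2|) (0, j)).
Qed.

Lemma norm_le_coord x (e : R) : 0 <= e -> (forall j, `|x 0 j| <= e) -> `|x| <= e.
Proof.
move=> e0 xe; rewrite [leLHS]/Num.Def.normr/= mx_normrE.
by apply: bigmax_le => // -[i j] _ /=; rewrite ord1.
Qed.

Section powsum.
Variables (p : R) (p1 : 1 <= p).
Let p0 : 0 < p. Proof. exact: lt_le_trans p1. Qed.
Let powsum x : R := \sum_(j < d) `|x 0 j| `^ p.

Let powsum_ge0 x : 0 <= powsum x.
Proof. by apply: sumr_ge0 => j _; exact: powR_ge0. Qed.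

Let qnorm_powR x : qnorm p%:E x `^ p = powsum x.
Proof. by rewrite /= -powRrM mulVf ?gt_eqF// powRr1 ?powsum_ge0. Qed.

Let coord_le_qnorm_fin x j : `|x 0 j| <= qnorm p%:E x.
Proof.
rewrite /= -[leLHS](@powRr1 _ `|x 0 j|)// -(@mulfV _ p) ?gt_eqF// powRrM.
rewrite ge0_ler_powR ?nnegrE ?invr_ge0 ?powR_ge0 ?(ltW p0) ?powsum_ge0//.
by rewrite (bigD1 j)//= lerDl sumr_ge0// => i _; exact: powR_ge0.
Qed.

Lemma qnormZ_fin (c : R) x : qnorm p%:E (c *: x) = `|c| * qnorm p%:E x.
Proof.
rewrite /=; under eq_bigr do rewrite mxE normrM powRM//.
rewrite -mulr_sumr powRM ?powR_ge0 ?powsum_ge0//.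
by rewrite -powRrM mulfV ?gt_eqF// powRr1.
Qed.

Let convex_powR_real (t a b : R) : 0 <= t <= 1 -> 0 <= a -> 0 <= b ->
  (t * a + (1 - t) * b) `^ p <= t * a `^ p + (1 - t) * b `^ p.
Proof.
move=> /andP[t0 t1] a0 b0.
pose t' : {i01 R} := Itv01 t0 t1.
have := @convex_powR R p p1 t' a b.
rewrite !inE/= !in_itv/= !andbT => /(_ a0 b0).
by rewrite !convRE.
Qed.

(** Minkowski's inequality, by convexity of r ^ p: with norms a and b, [(x + y) / (a + b)] is the
    convex combination of [x / a] and [y / b] with weights [a / (a + b)] and [b / (a + b)]. Zero
    norms are set apart because of the divisions. *)
Lemma qnormD_fin x y : qnorm p%:E (x + y) <= qnorm p%:E x + qnorm p%:E y.
Proof.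
have zero (z : 'rV[R]_d) : qnorm p%:E z = 0 -> z = 0.
  move=> z0; apply/rowP => j; rewrite mxE; apply/eqP.
  by rewrite -normr_le0 -[leRHS]z0 coord_le_qnorm_fin.
have [a xa] : exists a, qnorm p%:E x = a by eexists.
have [b yb] : exists b, qnorm p%:E y = b by eexists.
have a0 : 0 <= a by rewrite -xa; exact: powR_ge0.
have b0 : 0 <= b by rewrite -yb; exact: powR_ge0.
have [ae|an0] := eqVneq a 0.
  by rewrite (zero x) ?add0r ?xa// lerDr powR_ge0.
have [be|bn0] := eqVneq b 0.
  by rewrite (zero y) ?addr0 ?yb// lerDl powR_ge0.
rewrite xa yb.
have {an0}a0 : 0 < a by rewrite lt_def an0.
have {bn0}b0 : 0 < b by rewrite lt_def bn0.
have ab0 : 0 < a + b by exact: addr_gt0.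
suff : powsum (x + y) <= (a + b) `^ p.
  move=> h; rewrite -[leRHS](@powRr1 _ (a + b)) ?(ltW ab0)//.
  rewrite -(@mulfV _ p) ?gt_eqF// powRrM /= ge0_ler_powR//.
  - by rewrite invr_ge0 ltW.
  - by rewrite nnegrE powsum_ge0.
  - by rewrite nnegrE powR_ge0.
pose t := a / (a + b).
have t01 : 0 <= t <= 1.
  by rewrite divr_ge0 ?(ltW a0) ?(ltW ab0)//= ler_pdivrMr// mul1r lerDl ltW.
have tE : 1 - t = b / (a + b).
  by rewrite /t -{1}(@divff _ (a + b)) ?gt_eqF// -mulrBl addrC addKr.
have split1 j : `|(x + y) 0 j| `^ p <=
    (a + b) `^ p * (t * (`|x 0 j| / a) `^ p + (1 - t) * (`|y 0 j| / b) `^ p).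
  apply: (@le_trans _ _ ((a + b) `^ p *
      (t * (`|x 0 j| / a) + (1 - t) * (`|y 0 j| / b)) `^ p)); last first.
    by rewrite ler_wpM2l ?powR_ge0// convex_powR_real// divr_ge0// ltW.
  have ta : t * (`|x 0 j| / a) = `|x 0 j| / (a + b).
    by rewrite /t; field; rewrite !gt_eqF.
  have tb : (1 - t) * (`|y 0 j| / b) = `|y 0 j| / (a + b).
    by rewrite tE; field; rewrite !gt_eqF.
  rewrite ta tb -mulrDl -powRM ?divr_ge0 ?addr_ge0 ?(ltW ab0) ?(ltW a0) ?(ltW b0)//.
  rewrite mulrC divfK ?gt_eqF// ge0_ler_powR ?nnegrE ?(ltW p0) ?addr_ge0//.
  by rewrite mxE ler_normD.
apply: le_trans (ler_sum _ (fun j _ => split1 j)) _.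
rewrite -mulr_sumr ler_piMr ?powR_ge0// big_split/= -!mulr_sumr.
have unit (z : 'rV[R]_d) (c : R) : 0 < c -> qnorm p%:E z = c ->
    \sum_(j < d) (`|z 0 j| / c) `^ p = 1.
  move=> c0 zc; under eq_bigr do rewrite powRM ?invr_ge0 ?(ltW c0)//.
  rewrite -mulr_suml -[X in X * _]/(powsum z) -qnorm_powR zc.
  by rewrite -powRM ?invr_ge0 ?(ltW c0)// mulfV ?gt_eqF// powR1.
rewrite (unit x a)// (unit y b)// !mulr1.
by rewrite addrC subrK.
Qed.

Lemma norm_le_qnorm_fin x : `|x| <= qnorm p%:E x.
Proof. by apply: norm_le_coord => //; exact: powR_ge0. Qed.

Lemma qnorm_fin_le_norm x : qnorm p%:E x <= d%:R `^ p^-1 * `|x|.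
Proof.
have -> : d%:R `^ p^-1 * `|x| = (d%:R * `|x| `^ p) `^ p^-1.
  by rewrite powRM ?powR_ge0// -powRrM mulfV ?gt_eqF// powRr1.
rewrite ge0_ler_powR//.
- by rewrite invr_ge0 ltW.
- by rewrite nnegrE powsum_ge0.
- by rewrite nnegrE mulr_ge0// powR_ge0.
apply: (@le_trans _ _ (\sum_(j < d) `|x| `^ p)).
  by apply: ler_sum => j _; rewrite ge0_ler_powR ?nnegrE ?(ltW p0)// coord_le_norm.
by rewrite sumr_const card_ord mulr_natl.
Qed.

End powsum.

Lemma qnorm_pinfty x : qnorm +oo%E x = `|x|.
Proof.
apply/eqP; rewrite eq_le; apply/andP; split.
  by apply: bigmax_le => // j _; exact: coord_le_norm.
apply: norm_le_coord => [|j]; last exact: (le_bigmax _ (fun j => `|x 0 j|)).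
exact: bigmax_ge_id.
Qed.

Variables (q : \bar R) (hq : (1 <= q)%E).

Lemma qnormZ (c : R) x : qnorm q (c *: x) = `|c| * qnorm q x.
Proof.
case: q hq => [p|_|//]; first by rewrite lee_fin => /qnormZ_fin.
by rewrite !qnorm_pinfty normrZ.
Qed.

Lemma qnormD x y : qnorm q (x + y) <= qnorm q x + qnorm q y.
Proof.
case: q hq => [p|_|//]; first by rewrite lee_fin => /qnormD_fin.
by rewrite !qnorm_pinfty ler_normD.
Qed.

Lemma norm_le_qnorm x : `|x| <= qnorm q x.
Proof.
case: q hq => [p|_|//]; first by rewrite lee_fin => /norm_le_qnorm_fin.
by rewrite !qnorm_pinfty.
Qed.

Lemma qnorm_le_norm : exists2 C : R, 0 < C & forall x, qnorm q x <= C * `|x|.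
Proof.
case: q hq => [p|_|//]; last by exists 1 => // x; rewrite qnorm_pinfty mul1r.
rewrite lee_fin => p1; exists (d%:R `^ p^-1 + 1).
  by rewrite ltr_wpDl// powR_ge0.
move=> x; apply: le_trans (qnorm_fin_le_norm _ p1 x) _.
by rewrite ler_wpM2r// lerDl.
Qed.

Lemma qnorm_ge0 x : 0 <= qnorm q x.
Proof. exact: le_trans (norm_le_qnorm x). Qed.

Lemma qnormB x y : qnorm q (x - y) = qnorm q (y - x).
Proof. by rewrite -[in LHS]opprB -scaleN1r qnormZ normrN1 mul1r. Qed.

Lemma qnorm_dist x y : `|qnorm q x - qnorm q y| <= qnorm q (x - y).
Proof.
have h u v : qnorm q u - qnorm q v <= qnorm q (u - v).
  by rewrite lerBlDr (le_trans _ (qnormD _ _))// subrK.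
by rewrite ler_norml h andbT lerNl opprB qnormB h.
Qed.

Lemma dotDr u x y : dot u (x + y) = dot u x + dot u y.
Proof. by rewrite -big_split; apply: eq_bigr => j _; rewrite mxE mulrDr. Qed.

Lemma dotZr u (c : R) x : dot u (c *: x) = c * dot u x.
Proof. by rewrite mulr_sumr; apply: eq_bigr => j _; rewrite mxE mulrCA. Qed.

Lemma dotC u x : dot u x = dot x u.
Proof. by apply: eq_bigr => j _; rewrite mulrC. Qed.

(** Makes [dual_qnorm] a genuine supremum: on the unit ball every coordinate is at most 1, so the
    l1-norm of [u] is an upper bound. *)
Let dual_has_sup u : has_sup [set dot u x | x in [set x | qnorm q x <= 1]].
Proof.
split.
  exists (dot u 0); exists 0 => //=.
  by rewrite -(scale0r 0) qnormZ normr0 mul0r ler01.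
exists (\sum_(j < d) `|u 0 j|) => _ [x /= x1 <-].
apply: ler_sum => j _; apply: le_trans (ler_norm _) _.
rewrite normrM ler_piMr// (le_trans _ x1)//.
exact: le_trans (coord_le_norm _ _) (norm_le_qnorm _).
Qed.

Lemma dot_le_dual u x : dot u x <= dual_qnorm q u * qnorm q x.
Proof.
have [x0|xn0] := eqVneq (qnorm q x) 0.
  have -> : x = 0 by apply/eqP; rewrite -normr_le0 -[leRHS]x0 norm_le_qnorm.
  by rewrite -(scale0r 0) dotZr qnormZ normr0 !mul0r mulr0.
have x0 : 0 < qnorm q x by rewrite lt_def xn0 qnorm_ge0.
rewrite -ler_pdivrMr// mulrC -dotZr.
apply: sup_upper_bound (dual_has_sup u) _ _; exists ((qnorm q x)^-1 *: x) => //=.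
by rewrite qnormZ gtr0_norm ?invr_gt0// mulVf.
Qed.

Lemma dual_qnorm_ge0 u : 0 <= dual_qnorm q u.
Proof.
apply: sup_upper_bound (dual_has_sup u) _ _; exists 0 => /=.
  by rewrite -(scale0r 0) qnormZ normr0 mul0r ler01.
by rewrite -(scale0r 0) dotZr mul0r.
Qed.

End qnorm_theory.

(** * The vertex constraints bound the derivative on whole cells *)

Section bauer.
Context {R : realType}.

Lemma lipschitz_continuous (U W : normedModType R) (L : R) (g : U -> W) :
  (forall x y, `|g x - g y| <= L * `|x - y|) -> continuous g.
Proof.
move=> gL x; apply/cvgrPdist_le => e e0.
have L1 : 0 < `|L| + 1 by rewrite ltr_wpDl.
near=> y.
apply: le_trans (gL x y) _.
apply: (@le_trans _ _ ((`|L| + 1) * `|x - y|)).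
  by rewrite ler_wpM2r// (le_trans (ler_norm L))// lerDl.
rewrite mulrC -ler_pdivlMr//; near: y.
apply: cvgr_dist_le; first exact: cvg_id.
by rewrite divr_gt0.
Unshelve. all: by end_near. Qed.

Lemma dot_continuous d : continuous (fun x : 'rV[R]_d => dot x x).
Proof.
apply: continuous_big => [|j _ x]; first exact: add_continuous.
by apply: (@continuousM _ _ (fun z : 'rV[R]_d => z 0 j)
  (fun z : 'rV[R]_d => z 0 j)); exact: coord_continuous.
Qed.

(** Quantitative strict convexity of the squared Euclidean norm; the last term is the gap that
    separates extreme points. *)
Lemma dot_convex_comb d (u v : 'rV[R]_d) (t : R) :
  dot (t *: u + (1 - t) *: v) (t *: u + (1 - t) *: v) =
  t * dot u u + (1 - t) * dot v v - t * (1 - t) * dot (u - v) (u - v).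
Proof.
rewrite /dot !mulr_sumr -big_split -sumrB; apply: eq_bigr => j _ /=.
rewrite !mxE; ring.
Qed.

Lemma dot_gt0 d (u : 'rV[R]_d) : u != 0 -> 0 < dot u u.
Proof.
move=> u0; rewrite lt_def sumr_ge0 ?andbT => [|j _]; last by rewrite -expr2 sqr_ge0.
apply: contra u0; rewrite psumr_eq0 => [/allP uj|j _]; last by rewrite -expr2 sqr_ge0.
apply/eqP/rowP => j; rewrite mxE; apply/eqP.
by have := uj j; rewrite mem_index_enum => /(_ isT)/=; rewrite mulf_eq0 orbb.
Qed.

(* Among the maximisers of phi, one farthest from the origin is a vertex. *)
Lemma le_on_vertices d (K : set 'rV[R]_d) (phi : 'rV[R]_d -> R) (c : R) :
  compact K -> continuous phi ->
  (forall u v (t : R), 0 < t < 1 ->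
     phi (t *: u + (1 - t) *: v) <= t * phi u + (1 - t) * phi v) ->
  (forall y, vertices K y -> phi y <= c) ->
  forall x, K x -> phi x <= c.
Proof.
move=> Kcompact phicont phiconvex phic x Kx.
have [p /[!inE] Kp pmax] := compact_EVT_max (ex_intro _ x Kx) Kcompact
  (continuous_subspaceT phicont).
have {}pmax w : K w -> phi w <= phi p by move=> Kw; apply: pmax; rewrite inE.
apply: le_trans (pmax _ Kx) _.
(* Since [phi p] is the maximum on [K], this superlevel set is exactly the set of maximisers. *)
pose F := K `&` phi @^-1` [set r | phi p <= r].
have Fcompact : compact F.
  apply: compact_closedI => //; apply: closed_comp; last exact: closed_ge.
  by move=> w _; exact: phicont.
have Fp : F p by split => //=.
have [y /[!inE] -[Ky /= py] ymax] := compact_EVT_max (ex_intro _ p Fp) Fcompact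
  (continuous_subspaceT (@dot_continuous d)).
have {}ymax w : F w -> dot w w <= dot y y by move=> Fw; apply: ymax; rewrite inE.
apply: (le_trans py); apply: phic; split => // u v t Ku Kv /andP[t0 t1] yuv.
have t1' : 0 < 1 - t by rewrite subr_gt0.
have := phiconvex u v t; rewrite -yuv t0 t1 => /(_ isT) yconv.
(* A maximiser strictly between [u] and [v] forces both ends to be maximisers, by convexity of
   [phi]. *)
have Fu : F u.
  split => //=; rewrite leNgt; apply/negP => up.
  have h1 : t * phi u < t * phi p by rewrite ltr_pM2l.
  have h2 : (1 - t) * phi v <= (1 - t) * phi p by rewrite ler_pM2l// pmax.
  have := le_trans py yconv; lra.
have Fv : F v.
  split => //=; rewrite leNgt; apply/negP => vp.
  have h1 : (1 - t) * phi v < (1 - t) * phi p by rewrite ltr_pM2l.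
  have h2 : t * phi u <= t * phi p by rewrite ler_pM2l// pmax.
  have := le_trans py yconv; lra.
(* Otherwise the strict convexity gap would make [dot y y] smaller than itself. *)
have uv : u = v.
  apply/eqP; apply: contraT; rewrite -subr_eq0 => /dot_gt0 uv0.
  have := dot_convex_comb _ u v t; rewrite -yuv.
  have h1 : t * dot u u <= t * dot y y by rewrite ler_pM2l// ymax.
  have h2 : (1 - t) * dot v v <= (1 - t) * dot y y by rewrite ler_pM2l// ymax.
  have h3 : 0 < t * (1 - t) * dot (u - v) (u - v) by rewrite !mulr_gt0.
  lra.
by rewrite yuv uv -scalerDl addrC subrK scale1r.
Qed.

End bauer.

Section cell.
Context {R : realType} {d : nat}.
Variables (q : \bar R) (hq : (1 <= q)%E).

Lemma polyhedron_closed (P : set 'rV[R]_d) : polyhedron P -> closed P.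
Proof.
move=> [N [c [h [_ ->]]]].
have -> : [set x | forall j, dot (c j) x <= h j] =
    \bigcap_(j in setT) (dot (c j) @^-1` [set r | r <= h j]).
  by apply/seteqP; split => [x H j _|x H j]; [exact: H|exact: (H j I)].
apply: closed_bigI => j _; apply: closed_comp; last exact: closed_le.
move=> x _; move: x; apply: continuous_big => [|i _ x]; first exact: add_continuous.
apply: (@continuousM _ _ (cst (c j 0 i)) (fun z : 'rV[R]_d => z 0 i)).
  exact: cst_continuous.
exact: coord_continuous.
Qed.

Lemma polytope_compact (P : set 'rV[R]_d) : polytope P -> compact P.
Proof.
move=> [Pb [N [Q [QP PE]]]]; apply:  bounded_closed_compact => //.
rewrite PE; apply: closed_bigcup => [|j _]; [exact: finite_finset|exact: polyhedron_closed].
Qed.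

(** Writing f(x) as f(x_i) plus a difference, duality and the bound M give the expression [phi x],
    which is continuous and convex in x, so its values at the vertices control it. The field is
    evaluated only at [x] and at the data, so vertices may lie on the boundary of [X]. *)
Lemma derivative_le_on_cell n (X K : set 'rV[R]_d) (f : 'rV[R]_d -> 'rV[R]_d)
    (M c : R) (xd gam : 'I_n -> 'rV[R]_d) :
  0 <= M -> qlipschitz_field q M X f -> (forall i, X (xd i)) -> compact K ->
  (forall y, vertices K y -> \sum_(i < n) (dot (f (xd i)) (gam i)
     + M * dual_qnorm q (gam i) * qnorm q (xd i - y)) <= c) ->
  forall x, K x -> X x -> \sum_(i < n) dot (gam i) (f x) <= c.
Proof.
move=> M0 fM Xxd Kcompact Kc x Kx Xx.
pose phi y := \sum_(i < n) (dot (f (xd i)) (gam i)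
     + M * dual_qnorm q (gam i) * qnorm q (xd i - y)).
apply: (@le_trans _ _ (phi x)).
  apply: ler_sum => i _.
  rewrite -(subrK (f (xd i)) (f x)) dotDr addrC [X in X + _]dotC lerD2l.
  apply: le_trans (dot_le_dual _ hq _ _) _.
  rewrite (mulrC M) -mulrA ler_wpM2l ?dual_qnorm_ge0//.
  by rewrite (qnormB _ hq (xd i)) fM.
apply: (@le_on_vertices _ _ K) => //.
- have [C C0 qC] := @qnorm_le_norm R d q hq.
  apply: continuous_big => [|i _]; first exact: add_continuous.
  apply: (@lipschitz_continuous _ _ _ (M * dual_qnorm q (gam i) * C)) => u v.
  rewrite opprD addrACA subrr add0r -mulrBr normrM ger0_norm; last first.
    by rewrite mulr_ge0// dual_qnorm_ge0.
  rewrite -mulrA ler_wpM2l ?mulr_ge0 ?dual_qnorm_ge0//.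
  apply: le_trans (qnorm_dist _ hq _ _) _.
  by rewrite opprB addrC addrA subrK qnormB.
- move=> u v t /andP[t0 t1]; rewrite !mulr_sumr -big_split; apply: ler_sum => i _ /=.
  have -> : xd i - (t *: u + (1 - t) *: v) = t *: (xd i - u) + (1 - t) *: (xd i - v).
    by apply/rowP => j; rewrite !mxE; ring.
  set D := M * dual_qnorm q (gam i).
  have D0 : 0 <= D by rewrite mulr_ge0// dual_qnorm_ge0.
  have : D * qnorm q (t *: (xd i - u) + (1 - t) *: (xd i - v)) <=
      D * (t * qnorm q (xd i - u) + (1 - t) * qnorm q (xd i - v)).
    rewrite ler_wpM2l// (le_trans (qnormD _ hq _ _))//.
    by rewrite !qnormZ// !ger0_norm// ?(ltW t0)// subr_ge0 ltW.
  by lra.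
Qed.

End cell.

(** * Existence and uniqueness of solutions *)

Section calculus.
Context {R : realType} {d : nat}.
Implicit Types (x : R -> 'rV[R]_d) (t : R).

Lemma is_derive_rowP x t (v : 'rV[R]_d) :
  is_derive t (1 : R) x v <-> forall j, is_derive t (1 : R) (fun s => x s 0 j) (v 0 j).
Proof.
split=> [[dx xv] j|xj].
  split; first exact: (derivable_mxP _ _ _).1.
  by rewrite -xv (derive_mx dx) mxE.
have dx : derivable x t 1.
  by apply/derivable_mxP => i j; rewrite ord1; case: (xj j).
split => //; rewrite (derive_mx dx); apply/rowP => j; rewrite mxE.
by case: (xj j).
Qed.

Lemma is_derive_continuous (V : normedModType R) (g : R -> V) (t : R) (v : V) :
  is_derive t (1 : R) g v -> {for t, continuous g}.
Proof. by case=> dg _; apply: differentiable_continuous; apply/derivable1_diffP. Qed.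

Lemma is_derive_expRM (c k t : R) :
  is_derive t (1 : R) (fun s => c * expR (k * s)) (c * k * expR (k * t)).
Proof.
have h : is_derive t (1 : R) (fun s : R => k * s) (k * 1).
  exact: is_deriveZ.
have := @is_derive1_comp R expR (fun s => k * s) t _ _ (is_derive_expR (k * t)) h.
move=> h2; have := is_deriveZ c h2.
rewrite mulr1 => h3; apply: is_derive_eq h3 _.
by rewrite -[_ *: _]/(c * _); ring.
Qed.

Lemma primitive_real (g : R -> R) : continuous g ->
  exists G : R -> R, G 0 = 0 /\ forall t, 0 <= t -> is_derive t (1 : R) G (g t).
Proof.
move=> gc.
(* Integrating from -1 makes 0 an interior point, so that the derivative there is two-sided. *)
pose G t := \int[lebesgue_measure]_(s in `[-1, t]) g s.
exists (fun t => G t - G 0); split; first by rewrite subrr.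
move=> t t0.
have gint : lebesgue_measure.-integrable `[-1, t + 1] (EFin \o g).
  apply: continuous_compact_integrable; first exact: segment_compact.
  exact: continuous_subspaceT.
have t1 : t < t + 1 by rewrite ltrDl.
have Nt : -1 < t by rewrite (lt_le_trans _ t0)// ltrN10.
have [dG G't] := @continuous_FTC1_closed R g (-1) t (t + 1) t1 gint Nt (gc t).
have : is_derive t 1 G (g t) by split => //; rewrite -derive1E.
move=> HG.
rewrite -[g t]subr0; exact: is_deriveB.
Qed.

Lemma primitive (g : R -> 'rV[R]_d) : continuous g ->
  exists G : R -> 'rV[R]_d,
    G 0 = 0 /\ forall t, 0 <= t -> is_derive t (1 : R) G (g t).
Proof.
move=> gc.
have gjc j : continuous (fun t => g t 0 j).
  move=> t; apply: (@continuous_comp _ _ _ g (fun z : 'rV[R]_d => z 0 j)).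
    exact: gc.
  exact: coord_continuous.
have [G HG] := choice (fun j => primitive_real _ (gjc j)).
exists (fun t => \row_j G j t); split.
  by apply/rowP => j; rewrite !mxE (HG j).1.
move=> t t0; apply/is_derive_rowP => j.
under [X in is_derive _ _ X]eq_fun do rewrite mxE.
exact: (HG j).2.
Qed.

Lemma mean_value_le (u du v dv : R -> R) (a b : R) : a <= b ->
  (forall t, a <= t <= b -> is_derive t (1 : R) u (du t)) ->
  (forall t, a <= t <= b -> is_derive t (1 : R) v (dv t)) ->
  (forall t, a <= t <= b -> du t <= dv t) ->
  u b - u a <= v b - v a.
Proof.
move=> ab Du Dv uv.
have Dw t : a <= t <= b -> is_derive t (1 : R) (v - u) (dv t - du t).
  by move=> tab; have := Du t tab; have := Dv t tab => *; exact: is_deriveB.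
have [c|t|c cab] := @MVT_segment R (v - u) (fun t => dv t - du t) a b ab.
- by rewrite in_itv/= => /andP[ac cb]; apply: Dw; rewrite !ltW.
- apply: continuous_in_subspaceT => s; rewrite inE/= in_itv/= => /Dw.
  exact: is_derive_continuous.
move: cab; rewrite in_itv/= => /uv cuv.
rewrite -![(v - u) _]/(v _ - u _) => E.
have : 0 <= (dv c - du c) * (b - a) by rewrite mulr_ge0// subr_ge0.
by rewrite -E; lra.
Qed.

(** The mean value equality fails for vectors, but the sup norm lets the bound be checked on each
    coordinate and on its opposite. This plays the part of estimating a vector integral. *)
Lemma mean_value_norm_le (u du : R -> 'rV[R]_d) (v dv : R -> R) (a b : R) :
  a <= b ->
  (forall t, a <= t <= b -> is_derive t (1 : R) u (du t)) ->
  (forall t, a <= t <= b -> is_derive t (1 : R) v (dv t)) ->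
  (forall t, a <= t <= b -> `|du t| <= dv t) ->
  `|u b - u a| <= v b - v a.
Proof.
move=> ab Du Dv uv.
have key j : `|(u b - u a) 0 j| <= v b - v a.
  rewrite !mxE ler_norml; apply/andP; split.
    rewrite -subr_ge0 opprK -[X in 0 <= X]opprK oppr_ge0.
    have := @mean_value_le (fun t => - u t 0 j) (fun t => - du t 0 j) v dv a b ab.
    move=> H; suff : - u b 0 j - - u a 0 j <= v b - v a by lra.
    apply: H => // t tab; first by apply: is_deriveN; exact: (is_derive_rowP _ _ _).1 (Du t tab) j.
    by rewrite (le_trans _ (uv t tab))// (le_trans _ (coord_le_norm _ j))// -normrN ler_norm.
  apply: (@mean_value_le (fun t => u t 0 j) (fun t => du t 0 j) v dv a b ab) => // t tab.
    exact: (is_derive_rowP _ _ _).1 (Du t tab) j.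
  by rewrite (le_trans _ (uv t tab))// (le_trans _ (coord_le_norm _ j))// ler_norm.
apply: norm_le_coord => //.
have := @mean_value_le (fun=> 0) (fun=> 0) v dv a b ab.
rewrite subrr; apply => // t tab.
exact: le_trans (uv t tab).
Qed.

Lemma geometric_cauchy_limit (u : nat -> 'rV[R]_d) (E : R) :
  (forall n, `|u n.+1 - u n| <= E / 2 ^+ n) ->
  exists l, forall n, `|l - u n| <= 2 * E / 2 ^+ n.
Proof.
move=> uE.
have E0 : 0 <= E by have := uE 0; rewrite expr0 divr1; exact: le_trans.
(* Keeping the subtracted tail of the geometric series is what lets the induction on [m] close. *)
have um n m : `|u (n + m)%N - u n| <= 2 * E / 2 ^+ n - 2 * E / 2 ^+ (n + m).
  elim: m => [|m IH]; first by rewrite addn0 !subrr normr0.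
  rewrite addnS -(subrK (u (n + m)%N) (u _.+1)) -addrA.
  apply: le_trans (ler_normD _ _) _.
  have := uE (n + m)%N.
  have -> : E / 2 ^+ (n + m) = 2 * (E / 2 ^+ (n + m).+1).
    by rewrite exprS; field; rewrite expf_neq0.
  have : 2 * E / 2 ^+ (n + m) = 4 * (E / 2 ^+ (n + m).+1).
    by rewrite exprS; field; rewrite expf_neq0.
  move: IH; lra.
have ub n m : `|u (n + m)%N - u n| <= 2 * E / 2 ^+ n.
  by rewrite (le_trans (um n m))// gerBl divr_ge0 ?mulr_ge0 ?exprn_ge0.
have : cvg (u @ \oo).
  apply/cauchy_cvgP/cauchyP => e e0.
  have [N EN] : exists N, 2 * E / 2 ^+ N < e.
    have : geometric (2 * E) 2^-1 @ \oo --> 0.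
      by apply: cvg_geometric; rewrite ger0_norm ?invr_ge0// invf_lt1// ltr1n.
    move/cvgrPdist_lt => /(_ e e0)[N _ /(_ N (leqnn N))/=].
    rewrite sub0r normrN ger0_norm; last by rewrite !mulr_ge0 ?exprn_ge0 ?invr_ge0.
    by rewrite exprVn; exists N.
  exists (u N); exists N => // k /= Nk; rewrite -ball_normE/= distrC.
  by rewrite -(subnKC Nk) (le_lt_trans (ub _ _)).
move=> /cvg_ex[/= l ul]; exists l => n.
apply: (@closed_cvg _ _ \oo _ u [set z | `|z - u n| <= 2 * E / 2 ^+ n]) ul.
- have : closed ((fun z => `|z - u n|) @^-1` [set r | r <= 2 * E / 2 ^+ n]).
    apply: closed_comp; last exact: closed_le.
    move=> z _; apply: (@lipschitz_continuous _ _ _ 1) => y z'.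
    by rewrite mul1r (le_trans (ler_dist_dist _ _))// opprB addrA subrK.
  by [].
- by exists n => // k /= nk; rewrite -(subnKC nk).
Qed.

End calculus.

Section ode.
Context {R : realType} {d : nat}.
Variables (F : 'rV[R]_d -> 'rV[R]_d) (L : R).
Implicit Types (s t : R).
Hypotheses (L0 : 0 < L) (FL : forall x y, `|F x - F y| <= L * `|x - y|).

(** Picard iteration weighted by exp(2 L t): each step halves the weighted increment, so the
    iterates converge on the whole half-line at once and no local solutions have to be glued. *)
Lemma global_solution (x0 : 'rV[R]_d) :
  exists x : R -> 'rV[R]_d,
    x 0 = x0 /\ forall t, 0 <= t -> is_derive t (1 : R) x (F (x t)).
Proof.
have Fc : continuous F by exact: lipschitz_continuous FL.
have /choice[P HP] : forall g : R -> 'rV[R]_d, exists G : R -> 'rV[R]_d,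
    continuous g -> G 0 = 0 /\ forall t, 0 <= t -> is_derive t (1 : R) G (g t).
  move=> g; have [gc|] := pselect (continuous g); last by exists (fun=> 0).
  by have [G HG] := primitive g gc; exists G.
(* Evaluating at |s| keeps every integrand continuous on the whole line although
   the iterates are only controlled for s >= 0. *)
pose T (x : R -> 'rV[R]_d) := fun t => x0 + P (fun s => F (x `|s|)) t.
have absc (x : R -> 'rV[R]_d) : (forall t, 0 <= t -> {for t, continuous x}) ->
    continuous (fun s => F (x `|s|)).
  move=> xc s; apply: (@continuous_comp _ _ _ (fun s => x `|s|) F); last exact: Fc.
  apply: (@continuous_comp _ _ _ (fun s : R => `|s|) x); first exact: norm_continuous.
  exact: xc.
have TP x : continuous (fun s => F (x `|s|)) ->
    T x 0 = x0 /\ forall t, 0 <= t -> is_derive t (1 : R) (T x) (F (x t)).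
  move=> /HP[P0 PD]; split; first by rewrite /T P0 addr0.
  move=> t t0; rewrite /T -[F (x t)]add0r.
  by apply: is_deriveD; have := PD t t0; rewrite ger0_norm.
pose xs n := iter n T (fun=> x0).
have xsc n : continuous (fun s => F (xs n `|s|)).
  elim: n => [|n IH]; first exact: (@cst_continuous _ _ (F x0)).
  by apply: absc => t t0; exact: is_derive_continuous ((TP _ IH).2 t t0).
have xs0 n : xs n 0 = x0 by case: n => // n; exact: (TP _ (xsc n)).1.
have xsD n t : 0 <= t -> is_derive t (1 : R) (xs n.+1) (F (xs n t)).
  exact: (TP _ (xsc n)).2.
(* Integrating L exp(k s) gives at most exp(k t) / 2, hence the ratio 1/2; [C] is chosen so that
   [C * k] is the norm of the initial velocity. *)
pose k := 2 * L; have k0 : 0 < k by rewrite mulr_gt0.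
pose C := `|F x0| / k; have C0 : 0 <= C by rewrite divr_ge0// ltW.
have e1 t : 0 <= t -> 1 <= expR (k * t).
  by move=> t0; rewrite -[leLHS]expR0 ler_expR mulr_ge0// ltW.
have step n t : 0 <= t -> `|xs n.+1 t - xs n t| <= C * expR (k * t) / 2 ^+ n.
  elim: n t => [|n IH] t t0.
    have h s : 0 <= s <= t -> is_derive s (1 : R) (xs 1%N) (F x0).
      by move=> /andP[s0 _]; exact: xsD.
    have := @mean_value_norm_le R d (xs 1%N) (fun=> F x0)
      (fun s => C * expR (k * s)) (fun s => C * k * expR (k * s)) 0 t t0 h
      (fun s _ => is_derive_expRM C k s).
    rewrite xs0 expr0 divr1 => H; apply: le_trans (H _) _ => [s /andP[s0 _]|].
      by rewrite divfK ?gt_eqF// ler_peMr// e1.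
    by rewrite gerBl mulr_ge0// expR_ge0.
  pose c := C / 2 ^+ n.+1.
  have c0 : 0 <= c by rewrite divr_ge0// exprn_ge0.
  have h s : 0 <= s <= t ->
      is_derive s (1 : R) (xs n.+2 - xs n.+1) (F (xs n.+1 s) - F (xs n s)).
    by move=> /andP[s0 _]; apply: is_deriveB; exact: xsD.
  have := @mean_value_norm_le R d _ _
      (fun s => c * expR (k * s)) (fun s => c * k * expR (k * s)) 0 t t0 h
      (fun s _ => is_derive_expRM c k s).
  rewrite -[(xs n.+2 - xs n.+1) t]/(xs n.+2 t - xs n.+1 t).
  rewrite -[(xs n.+2 - xs n.+1) 0]/(xs n.+2 0 - xs n.+1 0) !xs0 !subrr subr0.
  move=> H; apply: le_trans (H _) _ => [s /andP[s0 _]|].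
    apply: le_trans (FL _ _) _.
    have -> : c * k * expR (k * s) = L * (C * expR (k * s) / 2 ^+ n).
      by rewrite /c /k exprS; field; rewrite expf_neq0.
    by rewrite ler_wpM2l ?(ltW L0)// IH.
  rewrite mulr0 expR0 mulr1 /c [leRHS]mulrAC gerBl divr_ge0// exprn_ge0//.
have /choice[y Hy] : forall t, exists l, 0 <= t ->
    forall n, `|l - xs n t| <= 2 * (C * expR (k * t)) / 2 ^+ n.
  move=> t; have [t0|t0] := leP 0 t; last by exists 0.
  have [l Hl] := geometric_cauchy_limit (fun n => xs n t) _ (fun n => step n t t0).
  by exists l.
have small (E e : R) : 0 < e -> exists n, E / 2 ^+ n < e.
  move=> e0.
  have : geometric E 2^-1 @ \oo --> 0.
    by apply: cvg_geometric; rewrite ger0_norm ?invr_ge0// invf_lt1// ltr1n.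
  move/cvgrPdist_lt => /(_ e e0)[N _ /(_ N (leqnn N))/=].
  rewrite sub0r normrN exprVn => h; exists N; apply: le_lt_trans h; exact: ler_norm.
(* The limit [y] is built pointwise. Convergence is uniform for [|s|] at most [|t| + 1], which gives
   continuity and allows [T] to be applied to [y]. *)
have hc : continuous (fun s => F (y `|s|)).
  move=> t; apply/cvgrPdist_le => e e0.
  have e3 : 0 < e / 3 by rewrite divr_gt0.
  have [n Hn] := small (L * (2 * (C * expR (k * (`|t| + 1))))) _ e3.
  have close s : `|s| <= `|t| + 1 -> `|F (y `|s|) - F (xs n `|s|)| <= e / 3.
    move=> st; apply: le_trans (FL _ _) _.
    apply: le_trans (ler_wpM2l (ltW L0) (Hy _ _ n)) _ => //.
    apply: le_trans (ltW Hn); rewrite -[leRHS]mulrA ler_wpM2l ?(ltW L0)//.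
    rewrite ler_wpM2r ?invr_ge0 ?exprn_ge0// ler_wpM2l// ler_wpM2l//.
    by rewrite ler_expR ler_wpM2l// ltW.
  have := xsc n t; move/cvgrPdist_le => /(_ _ e3) near_t.
  have near1 : \forall s \near t, `|t - s| <= 1.
    by apply/nbhs_ballP; exists 1 => //= s; exact: ltW.
  near=> s.
  have h1 := close t; rewrite lerDl ler01 in h1.
  have h2 : `|F (y `|s|) - F (xs n `|s|)| <= e / 3.
    apply: close; rewrite -(subrK t s) (le_trans (ler_normD _ _))// addrC lerD2l.
    by rewrite distrC; near: s.
  have h3 : `|F (xs n `|t|) - F (xs n `|s|)| <= e / 3 by near: s.
  have -> : F (y `|t|) - F (y `|s|) = (F (y `|t|) - F (xs n `|t|)) +
    (F (xs n `|t|) - F (xs n `|s|)) - (F (y `|s|) - F (xs n `|s|)).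
    by rewrite addrA subrK opprB addrA subrK.
  apply: le_trans (ler_normB _ _) _.
  apply: le_trans (lerD (ler_normD _ _) (lexx _)) _.
  have := h1 isT; lra.
have [Ty0 TyD] := TP y hc.
exists (T y); split => // t t0.
(* [T y] is differentiable by construction; it equals [y] because both are within a multiple of 2^-n
   of the iterate [xs n.+1]. *)
suff E s : 0 <= s -> T y s = y s by rewrite E//; exact: TyD.
move=> s0; apply/eqP; rewrite -subr_eq0 -normr_le0.
apply/ler_addgt0Pl => e e0; rewrite addr0.
have [n Hn] := small (2 * (2 * (C * expR (k * s)))) _ e0.
have h u : 0 <= u <= s ->
    is_derive u (1 : R) (T y - xs n.+1) (F (y u) - F (xs n u)).
  by move=> /andP[u0 _]; apply: is_deriveB; [exact: TyD|exact: xsD].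
pose c := C / 2 ^+ n.
have c0 : 0 <= c by rewrite divr_ge0// exprn_ge0.
have := @mean_value_norm_le R d _ _
    (fun s => c * expR (k * s)) (fun s => c * k * expR (k * s)) 0 s s0 h
    (fun s _ => is_derive_expRM c k s).
rewrite -[(T y - xs n.+1) s]/(T y s - xs n.+1 s).
rewrite -[(T y - xs n.+1) 0]/(T y 0 - xs n.+1 0) xs0 Ty0 subrr subr0 => H.
have {}H : `|T y s - xs n.+1 s| <= c * expR (k * s) - c * expR (k * 0).
  apply: H => u /andP[u0 _]; apply: le_trans (FL _ _) _.
  have -> : c * k * expR (k * u) = L * (2 * (C * expR (k * u)) / 2 ^+ n).
    by rewrite /c /k; ring.
  by rewrite ler_wpM2l ?(ltW L0)// Hy.
have H2 := Hy s s0 n.+1.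
rewrite -(subrK (xs n.+1 s) (T y s)) -addrA.
apply: le_trans (ler_normD _ _) _; rewrite (distrC _ (y s)).
apply: le_trans (ltW Hn); apply: le_trans (lerD H H2) _.
rewrite mulr0 expR0 mulr1.
have -> : 2 * (C * expR (k * s)) / 2 ^+ n.+1 = c * expR (k * s).
  by rewrite /c exprS; field; rewrite expf_neq0.
have -> : 2 * (2 * (C * expR (k * s))) / 2 ^+ n = 4 * (c * expR (k * s)).
  by rewrite /c; ring.
have : 0 <= c * expR (k * s) by rewrite mulr_ge0// expR_ge0.
lra.
Unshelve. all: by end_near. Qed.

End ode.

(** * Extension of Lipschitz maps *)

Section mcshane.
Context {R : realType}.

(** The extension is the infimum over y in [X] of the cones g(y) + L |x - y|: each is L-Lipschitz in
    x, and on [X] the cone with apex x is the lowest one at x. The empty set is treated apart, as it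
    provides no cone. *)
Lemma mcshane_extension (U : normedModType R) (X : set U) (g : U -> R) (L : R) :
  0 <= L -> (forall x y, X x -> X y -> `|g x - g y| <= L * `|x - y|) ->
  exists G : U -> R, (forall x, X x -> G x = g x) /\
    forall x y, `|G x - G y| <= L * `|x - y|.
Proof.
move=> L0 gL; have [[x0 Xx0]|X0] := pselect (X !=set0); last first.
  exists (fun=> 0); split => [x Xx|x y]; first by case: X0; exists x.
  by rewrite subrr normr0 mulr_ge0.
pose S x := [set g y + L * `|x - y| | y in X].
have SLB x y0 : X y0 -> lbound (S x) (g y0 - L * `|x - y0|).
  move=> Xy0 _ [y Xy <-].
  have := gL _ _ Xy0 Xy; rewrite ler_norml => /andP[_].
  have : L * `|y0 - y| <= L * `|x - y0| + L * `|x - y|.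
    by rewrite -mulrDr ler_wpM2l// (distrC x y0) -(subrKA x) ler_normD.
  lra.
have S0 x : S x !=set0 by exists (g x0 + L * `|x - x0|); exists x0.
have Shas x : has_inf (S x) by split; [exact: S0|exists (g x0 - L * `|x - x0|); exact: SLB].
have Gle x y : X y -> inf (S x) <= g y + L * `|x - y|.
  by move=> Xy; apply: ge_inf; [exact: (Shas x).2|exists y].
have half x x' : inf (S x) - inf (S x') <= L * `|x - x'|.
  rewrite lerBlDr addrC -lerBlDr; apply: lb_le_inf => // _ [y Xy <-].
  rewrite lerBlDr; apply: le_trans (Gle x y Xy) _; rewrite -addrA lerD2l -mulrDr.
  by rewrite ler_wpM2l// [leRHS]addrC -(subrKA x' x) ler_normD.
exists (fun x => inf (S x)); split => [x Xx|x y].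
  apply/eqP; rewrite eq_le; apply/andP; split.
    by have := Gle x x Xx; rewrite subrr normr0 mulr0 addr0.
  apply: lb_le_inf => //.
  by have := SLB x x Xx; rewrite subrr normr0 mulr0 subr0.
by rewrite ler_norml half andbT lerNl opprB distrC half.
Qed.

(** Extending each coordinate keeps the constant [L] because the norm is the sup norm. *)
Lemma mcshane_extension_rV d (X : set 'rV[R]_d) (f : 'rV[R]_d -> 'rV[R]_d) (L : R) :
  0 <= L -> (forall x y, X x -> X y -> `|f x - f y| <= L * `|x - y|) ->
  exists F : 'rV[R]_d -> 'rV[R]_d, (forall x, X x -> F x = f x) /\
    forall x y, `|F x - F y| <= L * `|x - y|.
Proof.
move=> L0 fL.
have fjL j x y : X x -> X y -> `|f x 0 j - f y 0 j| <= L * `|x - y|.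
  move=> Xx Xy; apply: le_trans (fL _ _ Xx Xy).
  by have := coord_le_norm (f x - f y) j; rewrite !mxE.
have [G HG] := choice (fun j => mcshane_extension _ X _ L L0 (fjL j)).
exists (fun x => \row_j G j x); split => [x Xx|x y].
  by apply/rowP => j; rewrite mxE (HG j).1.
apply: norm_le_coord => [|j]; first by rewrite mulr_ge0.
by rewrite !mxE (HG j).2.
Qed.

End mcshane.

(** * Uniqueness of solutions by an energy estimate *)

Section uniqueness.
Context {R : realType} {d : nat}.
Variables (F : 'rV[R]_d -> 'rV[R]_d) (L : R).
Hypotheses (L0 : 0 < L) (FL : forall x y, `|F x - F y| <= L * `|x - y|).
Implicit Types (s t : R) (u w : R -> 'rV[R]_d).

Lemma is_derive_dot (e : R -> 'rV[R]_d) t (v : 'rV[R]_d) :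
  is_derive t (1 : R) e v ->
  is_derive t (1 : R) (fun s => dot (e s) (e s)) (2 * dot (e t) v).
Proof.
move=> /is_derive_rowP ev.
have : is_derive t (1 : R) (\sum_(j < d) (fun s => e s 0 j * e s 0 j))
    (\sum_(j < d) (e t 0 j *: v 0 j + e t 0 j *: v 0 j)).
  apply: is_derive_sum => j; exact: is_deriveM (ev j) (ev j).
have -> : \sum_(j < d) (fun s => e s 0 j * e s 0 j) = (fun s => dot (e s) (e s)).
  by rewrite fct_sumE.
move=> h; apply: is_derive_eq h _.
rewrite /dot mulr_sumr; apply: eq_bigr => j _.
by rewrite -[_ *: _]/(_ * _); ring.
Qed.

(* Gronwall: |u - w|_2^2 exp (- 2 d L t) is nonincreasing. *)
Lemma solution_unique u w :
  u 0 = w 0 ->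
  {within [set t : R | 0 <= t], continuous u} ->
  {within [set t : R | 0 <= t], continuous w} ->
  (forall t, 0 < t -> is_derive t (1 : R) u (F (u t))) ->
  (forall t, 0 < t -> is_derive t (1 : R) w (F (w t))) ->
  forall t, 0 <= t -> u t = w t.
Proof.
move=> uw0 uc wc uD wD T T0.
pose e t := u t - w t.
pose k := - (2 * (d%:R * L)).
pose E t := dot (e t) (e t) * (1 * expR (k * t)).
pose dE t := dot (e t) (e t) *: (1 * k * expR (k * t)) +
  (1 * expR (k * t)) *: (2 * dot (e t) (F (u t) - F (w t))).
have ED t : t \in `]0, T[ -> is_derive t (1 : R) E (dE t).
  rewrite in_itv/= => /andP[t0 _].
  have De : is_derive t (1 : R) e (F (u t) - F (w t)).
    by apply: is_deriveB; [exact: uD|exact: wD].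
  exact: is_deriveM (is_derive_dot _ _ _ De) (is_derive_expRM 1 k t).
(* At time 0 only one-sided continuity is available; the mean value theorem asks for no more at an
   endpoint. *)
have Ec : {within `[0, T], continuous E}.
  have sub : `[0, T] `<=` [set t : R | 0 <= t].
    by move=> t /=; rewrite in_itv/= => /andP[].
  have {}uc := continuous_subspaceW sub uc.
  have {}wc := continuous_subspaceW sub wc.
  move=> t; apply: (@continuousM _ (subspace `[0, T])
    (fun s => dot (e s) (e s)) (fun s => 1 * expR (k * s))).
    apply: (@continuous_comp _ _ _ (e : subspace `[0, T] -> _) (fun z => dot z z)).
      by apply: continuousB; [exact: uc|exact: wc].
    exact: dot_continuous.
  apply: continuous_subspaceT => s.
  exact: is_derive_continuous (is_derive_expRM 1 k s).
have [c cT Ec0] := MVT_segment T0 ED Ec.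
have dE0 : dE c <= 0.
  (* Each coordinate product is at most L times the squared sup norm, hence at most L times the
     squared Euclidean norm; summing [d] of them explains the factor [d] in [k]. *)
  have cl j : e c 0 j * (F (u c) - F (w c)) 0 j <= L * dot (e c) (e c).
    apply: le_trans (ler_norm _) _; rewrite normrM.
    apply: (@le_trans _ _ (`|e c| * (L * `|e c|))).
      apply: ler_pM => //; first exact: coord_le_norm.
      exact: le_trans (coord_le_norm _ _) (FL _ _).
    rewrite mulrCA ler_wpM2l ?(ltW L0)//.
    have ge0 i : 0 <= e c 0 i * e c 0 i by rewrite -expr2 sqr_ge0.
    have D0 : 0 <= dot (e c) (e c) by apply: sumr_ge0.
    rewrite -expr2 -[leRHS]sqr_sqrtr// ler_sqr ?nnegrE ?sqrtr_ge0//.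
    apply: norm_le_coord => [|i]; first exact: sqrtr_ge0.
    rewrite -sqrtr_sqr ler_wsqrtr// expr2 /dot (bigD1 i)//= lerDl.
    exact: sumr_ge0.
  have : dot (e c) (F (u c) - F (w c)) <= d%:R * (L * dot (e c) (e c)).
    apply: le_trans (ler_sum _ (fun j _ => cl j)) _.
    by rewrite sumr_const card_ord mulr_natl.
  move=> h; rewrite /dE -![_ *: _]/(_ * _) /k.
  have -> : dot (e c) (e c) * (1 * - (2 * (d%:R * L)) * expR (- (2 * (d%:R * L)) * c))
    + 1 * expR (- (2 * (d%:R * L)) * c) * (2 * dot (e c) (F (u c) - F (w c)))
    = 2 * expR (- (2 * (d%:R * L)) * c) *
      (dot (e c) (F (u c) - F (w c)) - d%:R * (L * dot (e c) (e c))).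
    by ring.
  by rewrite mulr_ge0_le0 ?mulr_ge0 ?expR_ge0// subr_le0.
have E0 : E 0 = 0.
  by rewrite /E /e uw0 subrr -(scale0r 0) dotZr !mul0r.
have ET : E T <= 0.
  have : E T - E 0 <= 0 by rewrite Ec0 mulr_le0_ge0// subr0.
  by rewrite E0 subr0.
apply/eqP; rewrite -subr_eq0 -/(e T); apply: contraT => /dot_gt0 eT.
have : 0 < E T by rewrite mulr_gt0// mul1r expR_gt0.
by rewrite ltNge ET.
Qed.

End uniqueness.

(** * Decrease of V along trajectories *)

Section decrease.
Context {R : realType}.
Implicit Types (s t h : R).

(** Continuous induction: at the infimum of the bad times the bound still holds by continuity, and
    the local step carries it further. The step may assume the bound on the whole past, since local
    decrease is known only while the curve remains in the sublevel set. *)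
Lemma linear_decrease (phi : R -> R) (c : R) :
  (forall t, 0 <= t -> {for t, continuous phi}) ->
  (forall t, 0 <= t -> (forall s, 0 <= s <= t -> phi s <= phi 0 - c * s) ->
    exists2 e, 0 < e & forall h, 0 < h < e -> phi (t + h) <= phi t - c * h) ->
  forall t, 0 <= t -> phi t <= phi 0 - c * t.
Proof.
move=> phic step t t0; rewrite leNgt; apply/negP => bad.
pose B := [set s : R | 0 <= s /\ phi 0 - c * s < phi s].
have B0 : has_inf B by split; [exists t|exists 0 => s []].
pose tau := inf B.
have tau0 : 0 <= tau by apply: lb_le_inf; [exact: B0.1|move=> s []].
have good s : 0 <= s < tau -> phi s <= phi 0 - c * s.
  move=> /andP[s0 st]; rewrite leNgt; apply/negP => sbad.
  have : tau <= s by apply: ge_inf; [exact: B0.2|].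
  by rewrite leNgt st.
have goodtau : phi tau <= phi 0 - c * tau.
  have [->|tn0] := eqVneq tau 0; first by rewrite mulr0 subr0.
  have taup : 0 < tau by rewrite lt_def tn0.
  rewrite leNgt; apply/negP => tbad.
  pose psi s := phi s + c * s.
  have psic : {for tau, continuous psi}.
    apply: continuousD; first exact: phic.
    exact: mulrl_continuous.
  have gap : 0 < psi tau - phi 0 by rewrite /psi; lra.
  have := cvgr_dist_lt _ _ psic _ gap; move=> [e /= e0 He].
  (* A time just before [tau], kept nonnegative, where the bound holds although continuity at [tau]
     would violate it. *)
  pose s := Num.max 0 (tau - e / 2).
  have st : s < tau by rewrite gt_max taup/= gtrBl divr_gt0.
  have s0 : 0 <= s by rewrite le_max lexx.
  have hs : `|tau - s| < e.
    rewrite gtr0_norm ?subr_gt0// ltrBlDr -ltrBlDl.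
    rewrite lt_max; apply/orP; right; lra.
  have := good s; rewrite s0 st => /(_ isT) sg.
  have := He s hs => /=; rewrite ltNge => /negP; apply; apply: le_trans (ler_norm _).
  by rewrite lerB// /psi; lra.
have allgood s : 0 <= s <= tau -> phi s <= phi 0 - c * s.
  move=> /andP[s0]; rewrite le_eqVlt => /predU1P[->//|st].
  by apply: good; rewrite s0.
have [e e0 He] := step tau tau0 allgood.
have [b [b0 bbad] bt] := inf_adherent e0 B0.
have taub : tau <= b by apply: ge_inf; [exact: B0.2|].
move: taub; rewrite le_eqVlt => /predU1P[tb|tb].
  by move: bbad; rewrite -tb ltNge goodtau.
have := He (b - tau); rewrite subr_gt0 tb/= ltrBlDl bt => /(_ isT).
rewrite subrKC => hb; move: bbad; rewrite ltNge => /negP; apply.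
apply: le_trans hb _; lra.
Qed.

(** The curve differs from its tangent segment by o(h), which changes V by at most [(c - c') * h]
    for small h. *)
Lemma decrease_along_curve (U : normedModType R) (V : U -> R) (K c c' : R)
    (x : R -> U) t (v : U) :
  (forall y z, `|V y - V z| <= K * `|y - z|) -> c' < c ->
  is_derive t (1 : R) x v ->
  (exists2 e, 0 < e & forall h, 0 < h < e -> V (x t + h *: v) <= V (x t) - c * h) ->
  exists2 e, 0 < e & forall h, 0 < h < e -> V (x (t + h)) <= V (x t) - c' * h.
Proof.
move=> VK cc' [dx xv] [e1 e10 He1].
(* Replaces [K] by a Lipschitz constant that can be divided by. *)
have K1 : 0 < `|K| + 1 by rewrite ltr_wpDl.
have gap : 0 < (c - c') / (`|K| + 1) by rewrite divr_gt0// subr_gt0.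
move: dx => /cvg_ex[/= l xl].
have lv : l = v by rewrite -xv; apply/esym/cvg_lim.
rewrite {}lv in xl.
move/cvgrPdist_le : xl => /(_ _ gap)[e2 /= e20 He2].
exists (Num.min e1 e2) => [|h]; first by rewrite lt_min e10.
rewrite lt_min => /and3P[h0 h1 h2].
have := He2 h; rewrite /= sub0r normrN gtr0_norm// => /(_ h2).
rewrite gt_eqF// => /(_ isT); rewrite -[h *: 1]/(h * 1) mulr1 (addrC h t) => d1.
have d2 : `|x (t + h) - (x t + h *: v)| <= h * ((c - c') / (`|K| + 1)).
  rewrite -(ler_pM2l (_ : 0 < h^-1)) ?invr_gt0// mulKf ?gt_eqF//.
  apply: le_trans d1.
  rewrite -[X in X * _](gtr0_norm (_ : 0 < h^-1)) ?invr_gt0// -normrZ.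
  rewrite opprD addrA scalerBr scalerA mulVf ?gt_eqF// scale1r distrC.
  exact: lexx.
have d3 := He1 h; rewrite h0 h1 in d3.
have d4 := le_trans (ler_norm _) (VK (x (t + h)) (x t + h *: v)).
have d5 : K * `|x (t + h) - (x t + h *: v)| <= h * (c - c').
  apply: (@le_trans _ _ ((`|K| + 1) * `|x (t + h) - (x t + h *: v)|)).
    by rewrite ler_wpM2r// (le_trans (ler_norm K))// lerDl.
  apply: le_trans (ler_wpM2l (ltW K1) d2) _.
  suff -> : (`|K| + 1) * (h * ((c - c') / (`|K| + 1))) = h * (c - c') by [].
  by field; rewrite gt_eqF.
have := d3 isT; lra.
Qed.

(* A short enough segment from x stays in cells that contain x, and V is affine
   on each of them. *)
Lemma decrease_along_segment d (m : nat) (X A : set 'rV[R]_d)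
    (Y : 'I_m -> set 'rV[R]_d) (V : 'rV[R]_d -> R) (w : 'I_m -> 'rV[R]_d -> R)
    (beta : 'I_m -> R) (c : R) (x v : 'rV[R]_d) :
  open X -> closed A -> (forall k, closed (Y k)) -> X `\` A `<=` \bigcup_k Y k ->
  (forall k y h, w k (y + h *: v) = w k y + h * w k v) ->
  (forall k y, Y k y -> V y = w k y + beta k) ->
  X x -> ~ A x -> (forall k, Y k x -> w k v <= - c) ->
  exists2 e, 0 < e & forall h, 0 < h < e -> V (x + h *: v) <= V x - c * h.
Proof.
move=> Xo Ac Yc XAY wlin VY Xx Ax wc.
have near1 : \forall y \near x, X y by exact: open_nbhs_nbhs.
have near2 : \forall y \near x, ~ A y.
  by apply: open_nbhs_nbhs; split => //; exact: closed_openC.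
have near3 k : \forall y \near x, Y k y -> Y k x.
  have [Ykx|Ykx] := pselect (Y k x); first by near=> y.
  have : \forall y \near x, ~ Y k y.
    by apply: open_nbhs_nbhs; split => //; exact: closed_openC.
  by apply: filterS => y /[swap].
(* A cell missing [x] is closed, hence avoids a neighbourhood of [x]; finiteness of the family gives
   one neighbourhood for all cells. *)
have {}near3 := @filter_forall _ _ (fun k y => Y k y -> Y k x) (nbhs x) (nbhs_filter x) near3.
have : \forall y \near x, [/\ X y, ~ A y & forall k, Y k y -> Y k x].
  by near=> y; split; near: y.
have segc : {for (0 : R), continuous (fun h : R => x + h *: v)}.
  apply: continuousD; first exact: cst_continuous.
  exact: scalel_continuous.
rewrite -{1}[x]addr0 -{1}(scale0r v) => /segc[e /= e0 He].
exists e => // h /andP[h0 he].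
have [|Xh Ah Yh] := He h; first by rewrite /= sub0r normrN gtr0_norm.
(* The cell may change with [h], but it always contains [x] too, so one affine piece computes V at
   both ends. *)
have [k _ Ykh] := XAY _ (conj Xh Ah).
rewrite (VY _ _ Ykh) (VY _ _ (Yh _ Ykh)) wlin.
have : h * w k v <= h * - c by rewrite ler_pM2l// wc//; exact: Yh.
lra.
Unshelve. all: by end_near. Qed.

End decrease.

(** * Time shifts, and the slacks at the optimum *)

Section shift_and_optimum.
Context {R : realType}.

Lemma is_derive_shift_arg (W : normedModType R) (x : R -> W) (T t : R) (v : W) :
  is_derive (T + t) (1 : R) x v -> is_derive t (1 : R) (fun s => x (T + s)) v.
Proof.
have E : (fun h : R => h^-1 *: (x (h *: 1 + (T + t)) - x (T + t))) =
    (fun h : R => h^-1 *: (x (T + (h *: 1 + t)) - x (T + t))).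
  by apply/funext => h; rewrite addrCA.
by move=> [dx xv]; split; [move: dx|move: xv]; rewrite /derivable /derive/= E.
Qed.

Lemma tends_to_origin_shift d (q : \bar R) (x w : R -> 'rV[R]_d) (T : R) :
  (forall t, 0 <= t -> x (T + t) = w t) ->
  tends_to_origin q w -> tends_to_origin q x.
Proof.
move=> xw wlim; apply/cvgrPdist_lt => e e0.
move/cvgrPdist_lt : wlim => /(_ e e0)[N [Nreal HN]].
exists (Num.max N 0 + T); split; first exact: num_real.
move=> t /=; rewrite -ltrBrDr gt_max => /andP[Nt t0].
have := HN _ Nt => /=.
by rewrite -xw ?ltW// subrKC.
Qed.

Lemma inf_attained (S : set R) (a : R) : S a -> lbound S a -> inf S = a.
Proof.
move=> Sa aS; apply/eqP; rewrite eq_le; apply/andP; split.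
  by apply: ge_inf => //; exists a.
by apply: lb_le_inf => //; exists a.
Qed.

(* The objective attains the sum of the lower bounds of its terms, so each term
   attains its own. *)
Lemma optimal_slack d m n (nu : 'I_m -> nat) (q : \bar R) (A : set 'rV[R]_d)
    (Y : 'I_m -> set 'rV[R]_d) (y : forall k : 'I_m, 'I_(nu k) -> 'rV[R]_d)
    (xd fd : 'I_n -> 'rV[R]_d) (M eps : R) (z : @variables R d m n nu) :
  optimal (feasible q A Y y xd fd M eps) z ->
  optimal_value (feasible q A Y y xd fd M eps) = - eps * (\sum_(k < m) nu k)%:R ->
  forall k (l : 'I_(nu k)), s z l = - eps.
Proof.
move=> [Fz zmin]; rewrite /optimal_value (@inf_attained _ (objective z)); last 2 first.
- by exists z.
- by move=> _ [z' Fz' <-]; exact: zmin.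
move=> zval k l.
have ge0 k' (l' : 'I_(nu k')) : 0 <= s z l' + eps.
  by have [_ _ h _] := Fz k' l'; rewrite -lerBlDr sub0r.
have sum0 : \sum_(k < m) \sum_(l < nu k) (s z l + eps) = 0.
  under eq_bigr do rewrite big_split sumr_const card_ord/=.
  rewrite big_split/= -/(objective z) zval natr_sum mulNr mulr_sumr.
  rewrite addrC; apply/eqP; rewrite subr_eq0; apply/eqP.
  by apply: eq_bigr => i _; rewrite mulr_natr.
have sum0k : \sum_(l < nu k) (s z l + eps) = 0.
  move: sum0 => /psumr_eq0P; apply => // i _; exact: sumr_ge0.
have : s z l + eps = 0 by move: sum0k => /psumr_eq0P; apply.
by move/eqP; rewrite addr_eq0 => /eqP.
Qed.

End shift_and_optimum.

(** * Convergence from the sublevel sets of V *)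

Theorem proposition10 (R : realType) (d : nat) (q : \bar R) (hq : (1 <= q)%E)
  (X A : set 'rV[R]_d)
  (Xopen : open X) (Xbounded : bounded_set X)
  (Xpolytope : polytope (closure X)) (Apolytope : polytope A)
  (m : nat) (Y : 'I_m -> set 'rV[R]_d) (Ytess : tessellation X A Y)
  (nu : 'I_m -> nat) (y : forall k : 'I_m, 'I_(nu k) -> 'rV[R]_d)
  (yvert : vertex_enumeration Y y)
  (n : nat) (xd fd : 'I_n -> 'rV[R]_d)
  (M eps : R) (M_gt0 : 0 < M) (eps_gt0 : 0 < eps)
  (f : 'rV[R]_d -> 'rV[R]_d)
  (f_lipschitz : exists L, qlipschitz_field q L X f)
  (f_equilibrium : unique_equilibrium_at_origin X f)
  (f_stable : locally_asymptotically_stable q X f)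
  (f_data : forall i, X (xd i) /\ fd i = f (xd i))
  (A_compact : compact A)
  (A_roa : A `<=` (region_of_attraction q X f)°)
  (A_origin : A° 0)
  (f_M : qlipschitz_field q M X f)
  (z : @variables R d m n nu)
  (z_optimal : optimal (feasible q A Y y xd fd M eps) z)
  (z_value : optimal_value (feasible q A Y y xd fd M eps)
             = - eps * (\sum_(k < m) nu k)%:R)
  (V : 'rV[R]_d -> R) (V_candidate : lyapunov_candidate q A Y z V) :
  forall a : R, sublevel V a `<=` X ->
    sublevel V a `<=` region_of_attraction q X f.
Proof.
move=> a LaX x0 Vx0.
have [C C0 qC] := @qnorm_le_norm R d q hq.
have [Ypoly XAY _] := Ytess.
have Ycompact k : compact (Y k) by apply: polytope_compact; have [] := Ypoly k.
have [VY _ [Lv VL] _] := V_candidate.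
have VK u v : `|V u - V v| <= (`|Lv| * C) * `|u - v|.
  apply: le_trans (VL u v I I) _; rewrite -mulrA.
  apply: (@le_trans _ _ (`|Lv| * qnorm q (u - v))).
    by rewrite ler_wpM2r ?qnorm_ge0// ler_norm.
  by rewrite ler_wpM2l.
have MC0 : 0 < M * C by rewrite mulr_gt0.
have fMC u v : X u -> X v -> `|f u - f v| <= (M * C) * `|u - v|.
  move=> Xu Xv; apply: le_trans (norm_le_qnorm _ hq _) _.
  apply: le_trans (f_M _ _ Xu Xv) _; rewrite -mulrA ler_wpM2l ?(ltW M_gt0)//.
have [F [Ff FL]] := mcshane_extension_rV _ X f _ (ltW MC0) fMC.
have [x [x00 xD]] := global_solution F _ MC0 FL x0.
have xc t : 0 <= t -> {for t, continuous x}.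
  by move=> /xD; exact: is_derive_continuous.
have cell k v : Y k v -> X v -> \sum_(i < n) dot (gamma z i k) (f v) <= - eps.
  apply: (@derivative_le_on_cell _ _ q hq n X (Y k) f M (- eps) xd
    (fun i => gamma z i k)) => //; first exact: ltW.
    by move=> i; case: (f_data i).
  move=> w; rewrite -(yvert k).2 => -[l _ <-].
  have [_ _ _] := z_optimal.1 k l.
  rewrite (optimal_slack _ _ _ _ _ _ _ _ _ _ _ _ _ z_optimal z_value) => h.
  apply: le_trans h; apply: ler_sum => i _.
  by have [_ ->] := f_data i.
have [B XB] : exists B, forall v, X v -> `|v| <= B.
  have [N [_ HN]] := Xbounded; exists (N + 1) => v Xv.
  by apply: HN Xv; rewrite ltrDl.
(* [V (x t) <= V x0] puts [x t] in the sublevel set, hence in [X], where the velocity [F (x t)] is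
   [f (x t)]. *)
have dec t : 0 <= t -> V (x t) <= V x0 -> ~ A (x t) ->
    exists2 e, 0 < e & forall h, 0 < h < e -> V (x (t + h)) <= V (x t) - eps / 2 * h.
  move=> t0 Vxt Axt.
  have Xxt : X (x t) by apply: LaX; exact: le_lt_trans Vxt Vx0.
  apply: (@decrease_along_curve _ _ V _ eps (eps / 2) x t _ VK _ (xD t t0)).
    lra.
  rewrite (Ff _ Xxt).
  apply: (@decrease_along_segment _ _ m X A Y V
    (fun k v => \sum_(i < n) dot (gamma z i k) v) (fun k => b z k)) => //.
  - exact: compact_closed A_compact.
  - by move=> k; exact: compact_closed (Ycompact k).
  - by rewrite -XAY; exact: subset_closure.
  - move=> k u h; rewrite mulr_sumr -big_split.
    by apply: eq_bigr => i _; rewrite dotDr dotZr.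
  - by move=> k Yk; exact: cell.
(* The bound up to [T] is recorded with the hitting time: it keeps the curve in [X] until it can be
   matched with a trajectory from [A]. *)
have [T [T0 AT VT]] : exists T, [/\ 0 <= T, A (x T) &
    forall t, 0 <= t <= T -> V (x t) <= V x0].
  apply: contrapT => noT.
  have lin t : 0 <= t -> V (x t) <= V (x 0) - eps / 2 * t.
    apply: (@linear_decrease _ (fun t => V (x t))) => [u u0|u u0 Hu].
      apply: (@continuous_comp _ _ _ x V); first exact: xc.
      exact: lipschitz_continuous VK _.
    have Vu r : 0 <= r <= u -> V (x r) <= V x0.
      move=> ru; apply: le_trans (Hu r ru) _; rewrite x00 gerBl.
      by case/andP: ru => r0 _; rewrite mulr_ge0// divr_ge0// ltW.
    apply: dec => //; first by apply: Vu; rewrite u0 lexx.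
    by move=> Au; apply: noT; exists u.
  have VB v : X v -> V 0 - `|Lv| * C * B <= V v.
    move=> Xv; have := VK 0 v; rewrite sub0r normrN => h.
    have h1 : `|Lv| * C * `|v| <= `|Lv| * C * B.
      by rewrite ler_wpM2l ?XB// mulr_ge0// ltW.
    have := le_trans (ler_norm _) h; lra.
  (* At this time the linear decrease would bring V to 1 below its lower bound on [X]. *)
  pose t := (V x0 - (V 0 - `|Lv| * C * B) + 1) / (eps / 2).
  have t0 : 0 <= t.
    rewrite divr_ge0 ?divr_ge0 ?(ltW eps_gt0)// addr_ge0// subr_ge0 VB//.
    exact: LaX.
  have := lin t t0; rewrite x00 mulrC divfK; last by rewrite gt_eqF// divr_gt0.
  have Vxt : V (x t) < a.
    apply: le_lt_trans (lin t t0) _; rewrite x00; apply: le_lt_trans Vx0.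
    by rewrite gerBl mulr_ge0// divr_ge0// ltW.
  have := VB _ (LaX _ Vxt); lra.
have [XT [w [[w0 Xw wc wD] wlim]]] := interior_subset (A_roa _ AT).
(* The trajectory [w] stays in [X], where [F] and [f] agree, so both curves solve the extended
   equation with the same value at 0. *)
have xw t : 0 <= t -> x (T + t) = w t.
  move: t; apply: (solution_unique F _ MC0 FL (fun t => x (T + t)) w) => //.
  - by rewrite addr0 w0.
  - apply: continuous_in_subspaceT => t; rewrite inE/= => t0.
    have Tt : 0 <= T + t by rewrite addr_ge0.
    exact: is_derive_continuous (is_derive_shift_arg _ _ _ _ _ (xD _ Tt)).
  - move=> t t0; apply: is_derive_shift_arg; apply: xD.
    by rewrite addr_ge0// ltW.
  - by move=> t t0; rewrite Ff; [exact: wD|exact: Xw (ltW t0)].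
have Xx t : 0 <= t -> X (x t).
  move=> t0; have [tT|/ltW Tt] := leP t T.
    by apply: LaX; apply: le_lt_trans Vx0; apply: VT; rewrite t0.
  by rewrite -(subrKC T t) xw ?subr_ge0//; apply: Xw; rewrite subr_ge0.
split; first exact: LaX.
exists x; split; last exact: tends_to_origin_shift xw wlim.
split => //.
- by apply: continuous_in_subspaceT => t; rewrite inE; exact: xc.
- by move=> t t0; rewrite -Ff; [exact: xD (ltW t0)|exact: Xx (ltW t0)].
Qed.
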